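(* Let $G\cong C_{n_1}\oplus \cdots\oplus C_{n_r}$ be a finite abelian group with integers $1<n_1\mid n_2\mid\cdots \mid n_r$ and $r\ge 2$. Let $G_0\subseteq G$ be a subset with $|G_0|\le r+1$ and let $A$ be a separating atom over $G_0$ such that $|A|=\beta_{\mathrm{sep}}(G)$. Then $|\mathrm{supp}(A)|=|G_0|=r+1$.
   Context: $C_n$ denotes the cyclic group of order $n$; $\mathbb{N}_0$ is the set of nonnegative integers. For a finite group $G$ acting linearly on a finite-dimensional complex vector space $V$ (a $G$-module), a subset $S\subseteq \mathbb{C}[V]^G$ of the ring of invariants is separating if for all $v,w\in V$ with $Gv\ne Gw$ there is $f\in S$ with $f(v)\neq f(w)$. The separating Noether number $\beta_{\mathrm{sep}}(G)$ is the smallest positive integer $d$ such that for every finite-dimensional $G$-module $V$ over $\mathbb{C}$ there is a separating set consisting of invariant polynomials of degree at most $d$. For a nonempty subset $G_0$ of a finite abelian group $G$, $\mathcal{F}(G_0)$ is the free abelian monoid with basis $G_0$, written multiplicatively; its elements, called sequences over $G_0$, are $S=\prod_{g\in G_0}g^{\mathsf{v}_g(S)}$ with $\mathsf{v}_g(S)\in\mathbb{N}_0$. The length is $|S|=\sum_g \mathsf{v}_g(S)$, the sum is $\sigma(S)=\sum_g \mathsf{v}_g(S)g\in G$, and the support is $\mathrm{supp}(S)=\{g\in G_0 : \mathsf{v}_g(S)>0\}$. $\mathcal{B}(G_0)=\{S\in\mathcal{F}(G_0):\sigma(S)=0\}$ is the monoid of zero-sum sequences over $G_0$, with quotient (Grothendieck)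 group $q(\mathcal{B}(G_0))$. An atom over $G_0$ is a nontrivial zero-sum sequence over $G_0$ having no proper nontrivial zero-sum subsequence. For $d\in\mathbb{N}_0$, $\mathcal{B}(G_0)_d=\{S\in\mathcal{B}(G_0): |S|\le d\}$, and $q(\mathcal{B}(G_0)_d)$ denotes the subgroup of $q(\mathcal{B}(G_0))$ generated by $\mathcal{B}(G_0)_d$. A separating atom over $G_0$ is an atom $A$ over $G_0$ with $A\notin q(\mathcal{B}(G_0)_{|A|-1})$. *)

(* Defs.v *)
From HB Require Import structures.
From mathcomp Require Import all_boot all_order all_algebra all_fingroup.
From mathcomp Require Import mxrepresentation.
From mathcomp Require Import complex.
From mathcomp Require Import classical_sets reals.
From mathcomp Require Import mpoly.

Set Implicit Arguments.
Unset Strict Implicit.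
Unset Printing Implicit Defensive.

Import GRing.Theory.
Local Open Scope ring_scope.

Section SeparatingNoetherNumber.

(* The base field is R[i] for a model R of the real numbers. *)
Variables (R : realType) (gT : finGroupType) (G : {group gT}).

Section Module.

(* V = C^m as column vectors, on which g acts by v |-> rG g *m v. *)
Variables (m : nat) (rG : mx_representation R[i] G m).

Definition module_orbit (v : 'cV[R[i]]_m) : set 'cV[R[i]]_m :=
  [set w | exists2 g, g \in G & w = rG g *m v]%classic.

Definition poly_at (f : {mpoly R[i][m]}) (v : 'cV[R[i]]_m) : R[i] :=
  f.@[fun i => v i ord0].

(* Over an infinite field, a polynomial is determined by its values, so
   invariance can be tested pointwise. *)
Definition invariant_poly (f : {mpoly R[i][m]}) : Prop :=
  forall g v, g \in G -> poly_at f (rG g *m v) = poly_at f v.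

Definition separating_set (S : set ({mpoly R[i][m]})) : Prop :=
  (forall f, S f -> invariant_poly f) /\
  (forall v w, module_orbit v <> module_orbit w ->
     exists2 f, S f & poly_at f v <> poly_at f w).

End Module.

(* msize f is the total degree plus one, and 0 for f = 0. *)
Definition separated_in_degree (d : nat) : Prop :=
  forall (m : nat) (rG : mx_representation R[i] G m),
    exists2 S : set ({mpoly R[i][m]}),
      separating_set rG S & forall f, S f -> (msize f <= d.+1)%N.

Definition is_beta_sep (d : nat) : Prop :=
  [/\ (0 < d)%N, separated_in_degree d
    & forall e, (0 < e)%N -> separated_in_degree e -> (d <= e)%N].

End SeparatingNoetherNumber.

Section ZeroSumSequences.

Variable G : finZmodType.

(* A sequence S over G is its multiplicity function g |-> v_g(S); the product
   of sequences is pointwise addition and the trivial sequence is 0. *)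
Definition sequence := {ffun G -> nat}.

Implicit Types S T A : sequence.

Definition seq_length S : nat := (\sum_g S g)%N.

Definition seq_sum S : G := \sum_g g *+ S g.

Definition seq_supp S : {set G} := [set g | (0 < S g)%N].

Definition subsequence T S : Prop := forall g, (T g <= S g)%N.

Definition zero_sum_over (G0 : {set G}) S : Prop := seq_supp S \subset G0 /\ seq_sum S = 0.

Definition atom_over (G0 : {set G}) A : Prop :=
  [/\ zero_sum_over G0 A, A <> 0
    & forall T, subsequence T A -> zero_sum_over G0 T -> T = 0 \/ T = A].

(* F(G) is embedded in its quotient group, the integer-valued functions on G.
   Since B(G0) is a submonoid of F(G), its quotient group q(B(G0)), and hence
   every subgroup of it, is a subgroup of that group. *)
Definition to_quotient S : {ffun G -> int} := [ffun g => (S g)%:Z].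

Definition is_subgroup (V : zmodType) (H : set V) : Prop :=
  H 0 /\ forall x y, H x -> H y -> H (x - y).

Definition quotient_of_bounded (G0 : {set G}) (d : nat) : set {ffun G -> int} :=
  smallest (@is_subgroup _)
    [set to_quotient S | S in
       [set S | zero_sum_over G0 S /\ (seq_length S <= d)%N]]%classic.

Definition separating_atom_over (G0 : {set G}) A : Prop :=
  atom_over G0 A /\
  ~ quotient_of_bounded G0 (seq_length A).-1 (to_quotient A).

End ZeroSumSequences.

(* Main.v *)
From mathcomp Require Import boolp classical_sets.
From mathcomp Require Import mxrepresentation separable cyclic cyclotomic complex mpoly.
Require Import Defs.
From mathcomp Require Import all_boot all_order all_algebra all_fingroup.
From mathcomp Require Import reals zify ring.

(** Let L(I) be the group of integer relations among the elements of a set I of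
    group elements: the vectors x supported on I with sum_g x_g g = 0. Its
    nonnegative elements are the zero-sum sequences over I. That an atom A is
    separating means that the shorter zero-sum sequences do not generate A
    inside the relation group. Put l = r/2 (rounded down), index the invariants
    from 0, set n_i = 1 for i >= r, and let T = n_l + n_(l+1) + ... + n_(2l).
    Two estimates are played against each other: beta_sep(G) is at least T,
    whereas over at most r elements the zero-sum sequences of length < T
    generate all relations. So a separating atom of length beta_sep(G) >= T
    cannot be supported on r elements.

    Lower bound ([long_module_not_separated]). Let q be a prime divisor of n_0.
    A diagonal module with coordinates X_i, Y_i for 0 <= i <= l is chosen so
    that a monomial is invariant only if n_(l+i) divides X_i + Y_i for every i
    and, modulo q, all exponents X_i agree with X_l. An invariant monomial in
    which q does not divide X_l has every X_i > 0, hence degree at least T. So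
    the points (1, ..., 1) and (1, ..., zeta, ..., 1), with a primitive q-th
    root of unity zeta in coordinate X_l, are not told apart in degree < T,
    although they lie in different orbits.

    Upper bound ([relation_generated]). Membership in a subgroup can be tested
    after inverting everything prime to q, for each prime q in turn
    ([localized_all]). Fix q and argue by induction on I. Take k = |I| >= 2,
    h = n_c with c + ceil(k/2) = r. Then hG has fewer than ceil(k/2) cyclic
    factors, of orders n_i/h for i > c, and two facts combine.

    - Relations divisible by h are already generated ([relation_mul]): modulo q
      the elements hg (g in I) are combinations of a subset V of them with
      |V| <= k - 2, and two elements of I outside V let one modify such a
      relation until some coordinate is divisible by the q-part of |G|. That
      coordinate can then be removed, and induction applies.
    - Every element of the group generated by the hg is a sum of at most
      D = sum_(i > c) (n_i/h - 1) of them ([span_short_sum]); this is the bound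
      for the directed diameter of a Cayley graph of an abelian group.

    Given a relation x, write x = f + h m with 0 <= f_g < h. Replacing m, and
    the corresponding quotient of -x, by short nonnegative combinations changes
    x and -x only by relations divisible by h and yields two zero-sum sequences
    of total length at most kh + 2hD ([relation_halve]). That is less than 2T
    ([box_le_long_length]), so one of the two has length < T, and x is
    generated. *)

Set Implicit Arguments.
Unset Strict Implicit.
Unset Printing Implicit Defensive.

Import GRing.Theory.
Local Open Scope ring_scope.

(** * Subgroups generated by finite families *)

Section Span.

Variable G : finZmodType.
Implicit Types W J : {set G}.

Definition add_closed W :=
  0 \in W /\ forall x y, x \in W -> y \in W -> x + y \in W.

Lemma mulrn_card (x : G) : x *+ #|G| = 0.
Proof. by rewrite -FinRing.zmodXgE -cardsT expg_cardG ?inE. Qed.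

Lemma add_closedMn W x k : add_closed W -> x \in W -> x *+ k \in W.
Proof.
move=> [W0 WD] Wx; elim: k => [|k IH]; first by rewrite mulr0n.
by rewrite mulrS WD.
Qed.

Lemma oppr_mulrn (x : G) : - x = x *+ #|G|.-1.
Proof.
apply/eqP; rewrite eq_sym -addr_eq0 addrC -mulrS prednK ?mulrn_card //.
by apply/card_gt0P; exists 0.
Qed.

Lemma add_closedB W x y :
  add_closed W -> x \in W -> y \in W -> x - y \in W.
Proof. by move=> cW Wx Wy; rewrite oppr_mulrn; apply: cW.2 => //; apply: add_closedMn. Qed.

Lemma add_closed_sum W (T : Type) (s : seq T) (P : pred T) (F : T -> G) :
  add_closed W -> (forall t, P t -> F t \in W) -> \sum_(t <- s | P t) F t \in W.
Proof. by move=> [W0 WD] FW; apply: (big_ind (fun x => x \in W)). Qed.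

Lemma add_closed_coprime W x k p : add_closed W -> (0 < p)%N -> coprime p k ->
  x *+ p \in W -> x *+ k \in W -> x \in W.
Proof.
move=> cW p0 /eqP cop Wp Wk; have [a _] := Bezoutl k p0.
rewrite cop => /dvdnP[m e].
have -> : x = x *+ (1 + a * k) - x *+ (a * k) by rewrite mulrnDr mulr1n addrK.
rewrite e [(a * k)%N]mulnC [(m * p)%N]mulnC !mulrnA.
by apply: add_closedB => //; apply: add_closedMn.
Qed.

Definition mul_set W p : {set G} := [set x *+ p | x in W].
Definition torsion W p : {set G} := [set x in W | x *+ p == 0].

Lemma mul_set_closed W p : add_closed W -> add_closed (mul_set W p).
Proof.
move=> [W0 WD]; split; first by apply/imsetP; exists 0; rewrite ?mul0rn.
move=> _ _ /imsetP[x Wx ->] /imsetP[y Wy ->].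
by apply/imsetP; exists (x + y); rewrite ?mulrnDl ?WD.
Qed.

(** Multiplication by p maps W onto pW, and its fibres are the cosets of the
    p-torsion. *)
Lemma card_mul_torsion W p :
  add_closed W -> #|W| = (#|mul_set W p| * #|torsion W p|)%N.
Proof.
move=> cW; rewrite -sum1_card (partition_big (fun x => x *+ p) (mem (mul_set W p))) /=;
  last by move=> x Wx; apply: imset_f.
rewrite -sum_nat_const; apply: eq_bigr => _ /imsetP[x0 Wx0 ->].
rewrite -(card_imset _ (addrI x0)) -sum1_card; apply: eq_bigl => x.
apply/andP/imsetP => [[Wx /eqP xp]|[y]].
  exists (x - x0); last by rewrite addrC subrK.
  by rewrite inE add_closedB //= mulrnBl xp subrr.
rewrite inE => /andP[Wy /eqP yp] ->.
by split; [apply: cW.2 | rewrite mulrnDl yp addr0].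
Qed.

Definition adjoin W x p : {set G} := [set w + x *+ nat_of_ord i | w in W, i in [set: 'I_p]].

Lemma adjoin_closed W x p :
  (0 < p)%N -> add_closed W -> x *+ p \in W -> add_closed (adjoin W x p).
Proof.
move=> p0 cW Wxp; split.
  by apply/imset2P; exists 0 (Ordinal p0); rewrite ?inE ?mulr0n ?addr0 //; apply: cW.1.
move=> _ _ /imset2P[w i Ww _ ->] /imset2P[w' i' Ww' _ ->].
apply/imset2P; exists (w + w' + x *+ p *+ ((i + i') %/ p)) (Ordinal (ltn_pmod (i + i') p0)).
- by apply: cW.2; [apply: cW.2 | apply: add_closedMn].
- by rewrite inE.
rewrite /= addrACA -mulrnDr -[RHS]addrA; congr (_ + _).
by rewrite -mulrnA -mulrnDr mulnC -divn_eq.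
Qed.

(** The sums w + i x with 0 <= i < p are distinct: otherwise a multiple of x
    prime to p would lie in W, and with it x. *)
Lemma card_adjoin W x p : prime p -> add_closed W -> x *+ p \in W ->
  x \notin W -> #|adjoin W x p| = (p * #|W|)%N.
Proof.
move=> pp cW Wxp Wx; rewrite /adjoin curry_imset2X card_in_imset.
  by rewrite cardsX cardsT card_ord mulnC.
have aux w w' (i j : 'I_p) : w \in W -> w' \in W -> (i <= j)%N ->
    w + x *+ i = w' + x *+ j -> i = j.
  move=> Ww Ww' lij e; apply/eqP; rewrite -val_eqE eqn_leq lij /=.
  rewrite leqNgt; apply/negP => ltij; case/negP: Wx.
  apply: (@add_closed_coprime _ _ (j - i) p) => //; first exact: prime_gt0.
    rewrite prime_coprime // gtnNdvd ?subn_gt0 //.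
    by apply: leq_ltn_trans (ltn_ord j); apply: leq_subr.
  suff -> : x *+ (j - i) = w - w' by apply: add_closedB.
  have -> : w = w' + x *+ j - x *+ i by rewrite -e addrK.
  by rewrite mulrnBr // -[w' + _ + _]addrA [w' + _]addrC addrK.
move=> [w i] [w' j] /setXP[/= Ww _] /setXP[/= Ww' _] e.
suff eij : i = j by move: e; rewrite eij => /addIr ->.
case/orP: (leq_total i j) => lij; first exact: (aux w w').
by apply/esym; apply: (aux w' w).
Qed.

Lemma subset_adjoin W x p : (0 < p)%N -> W \subset adjoin W x p.
Proof.
move=> p0; apply/subsetP => w Ww; apply/imset2P.
by exists w (Ordinal p0); rewrite ?inE ?mulr0n ?addr0.
Qed.

Lemma mem_adjoin W x p : (1 < p)%N -> 0 \in W -> x \in adjoin W x p.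
Proof.
move=> p1 W0; apply/imset2P; exists 0 (Ordinal p1) => //.
by rewrite add0r.
Qed.

Section Family.

Variables (T : finType) (u : T -> G).

(** Members of the family are adjoined one after the other, those already
    obtained being skipped. Each adjunction multiplies the order by p, so the
    number of members kept can be read off from the order of the result. *)
Lemma adjoin_family p (s : seq T) W : prime p -> uniq s -> add_closed W ->
    (forall t, t \in s -> u t *+ p \in W) ->
  exists V : seq T, exists W' : {set G},
  [/\ uniq V, {subset V <= s}, add_closed W' /\ #|W'| = (p ^ size V * #|W|)%N,
      forall t, t \in s -> u t \in W'
    & W \subset W' /\ forall x, x \in W' -> exists2 w, w \in W & exists2 c : T -> nat,
       forall t, (c t < p)%N & x = w + \sum_(t <- V) u t *+ c t].
Proof.
move=> pp; have p0 := prime_gt0 pp; elim: s W => [|t s IH] W.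
  move=> _ cW _; exists [::], W; split=> //; first by rewrite mul1n.
  split=> // x Wx; exists x => //; exists (fun=> 0%N) => //.
  by rewrite big_nil addr0.
move=> /= /andP[ts us] cW uW.
have uWs t' : t' \in s -> u t' *+ p \in W by move=> st; apply: uW; rewrite inE st orbT.
have [Wt|Wt] := boolP (u t \in W).
  have [V [W' [uV sV cW' sW' [WW' rW']]]] := IH W us cW uWs.
  exists V, W'; split=> // t'; first by move/sV; rewrite inE orbC => ->.
  by rewrite inE => /predU1P[->|/sW'] //; apply: (subsetP WW').
have Wtp : u t *+ p \in W by apply: uW; rewrite mem_head.
have sub := subset_adjoin W (u t) p0.
have [||V [W' [uV sV [cW' oW'] sW' [WW' rW']]]] := IH (adjoin W (u t) p) us.
- exact: adjoin_closed.
- by move=> t' st; apply: (subsetP sub); apply: uWs.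
have tV : t \notin V by apply: contra ts => /sV.
exists (t :: V), W'; split=> /=.
- by rewrite tV.
- by move=> t'; rewrite !inE => /predU1P[->|/sV ->]; rewrite ?eqxx ?orbT.
- by split=> //; rewrite oW' card_adjoin // expnSr mulnA.
- move=> t'; rewrite inE => /predU1P[->|/sW'] //; apply: (subsetP WW').
  by apply: mem_adjoin; [apply: prime_gt1 | apply: cW.1].
split; first exact: subset_trans WW'.
move=> x /rW'[w /imset2P[w0 i Ww0 _ ->] [c cp ->]].
exists w0 => //; exists (fun t' => if t' == t then i : nat else c t').
  by move=> t'; case: eqP.
rewrite big_cons eqxx -addrA; congr (_ + (_ + _)).
by apply: eq_big_seq => t' t'V; case: eqP => // tt; rewrite -tt t'V in tV.
Qed.

Definition span (I : {set T}) : {set G} :=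
  [set x | `[< exists c : T -> nat, x = \sum_(t in I) u t *+ c t >]].

Lemma spanP (I : {set T}) x :
  reflect (exists c : T -> nat, x = \sum_(t in I) u t *+ c t) (x \in span I).
Proof. by rewrite inE; apply: asboolP. Qed.

Lemma span_closed (I : {set T}) : add_closed (span I).
Proof.
split; first by apply/spanP; exists (fun=> 0%N); rewrite big1.
move=> _ _ /spanP[c ->] /spanP[c' ->]; apply/spanP; exists (fun t => (c t + c' t)%N).
by rewrite -big_split; apply: eq_bigr => t _; rewrite mulrnDr.
Qed.

Lemma mem_span (I : {set T}) t : t \in I -> u t \in span I.
Proof.
move=> It; apply/spanP; exists (fun t' => (t' == t)).
by rewrite (bigD1 t) //= eqxx big1 ?addr0 // => t' /andP[_ /negbTE ->].
Qed.

Lemma span_min (I : {set T}) W : add_closed W -> (forall t, t \in I -> u t \in W) ->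
  span I \subset W.
Proof.
move=> cW uW; apply/subsetP => _ /spanP[c ->].
by apply: add_closed_sum => // t It; apply: add_closedMn => //; apply: uW.
Qed.

(** Adjoin the generators to pJ, where J is their span. The kept generators V
    give |J| = p^|V| |pJ|, so |V| is also the rank of the p-torsion of J. In
    that form it is monotone in J, which |J / pJ| does not show directly. *)
Lemma span_mod_prime p (I : {set T}) : prime p ->
  exists V : {set T}, [/\ V \subset I, #|torsion (span I) p| = (p ^ #|V|)%N
  & forall x, x \in span I -> exists2 c : T -> nat, forall t, (c t < p)%N &
    exists2 y, y \in span I & x = \sum_(t in V) u t *+ c t + y *+ p].
Proof.
move=> pp; set J := span I; have cJ : add_closed J by apply: span_closed.
have cpJ := mul_set_closed p cJ.
have [|V [W' [uV sV [cW' oW'] sW' [WW' rW']]]] :=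
  @adjoin_family p (enum I) (mul_set J p) pp (enum_uniq _) cpJ.
  by move=> t; rewrite mem_enum => It; apply: imset_f; apply: mem_span.
have sVI t : t \in V -> t \in I by move/sV; rewrite mem_enum.
have JW' : J \subset W'.
  by apply: span_min => // t It; apply: sW'; rewrite mem_enum.
have W'J : W' \subset J.
  apply/subsetP => x /rW'[_ /imsetP[y Jy ->] [c _ ->]].
  apply: cJ.2; first exact: add_closedMn.
  rewrite big_seq; apply: add_closed_sum => // t /sVI It.
  by apply: add_closedMn => //; apply: mem_span.
have eW : W' = J by apply/eqP; rewrite eqEsubset W'J.
exists [set t in V]; split.
- by apply/subsetP => t; rewrite inE => /sVI.
- have := card_mul_torsion p cJ; rewrite -{1}eW oW' mulnC.
  have -> : #|[set t in V]| = size V by rewrite cardsE; apply/card_uniqP.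
  move/eqP; rewrite eqn_pmul2l => [/eqP //|].
  by apply/card_gt0P; exists 0; apply: cpJ.1.
move=> x; rewrite -eW => /rW'[_ /imsetP[y Jy ->] [c cp ->]]; exists c => //.
exists y; rewrite ?eW // addrC; congr (_ + _).
rewrite big_uniq //; apply: eq_bigl => t; by rewrite inE.
Qed.

End Family.

Lemma torsionS W J p : W \subset J -> torsion W p \subset torsion J p.
Proof.
by move=> /subsetP sWJ; apply/subsetP => x; rewrite !inE => /andP[/sWJ -> ->].
Qed.

(** A family whose span lies in a group with |D| generators needs at most |D|
    of its members modulo p, because ranks of p-torsion can be compared along
    an inclusion. *)
Lemma span_mod_prime_rank (T K : finType) (u : T -> G) (b : K -> G) p
    (I : {set T}) (D : {set K}) : prime p -> span u I \subset span b D ->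
  exists V : {set T}, [/\ V \subset I, (#|V| <= #|D|)%N
  & forall x, x \in span u I -> exists2 c : T -> nat, forall t, (c t < p)%N &
    exists2 y, y \in span u I & x = \sum_(t in V) u t *+ c t + y *+ p].
Proof.
move=> pp sub; have [V [VI oV rV]] := span_mod_prime u I pp.
have [VD [VDD oVD _]] := span_mod_prime b D pp.
exists V; split=> //; apply: leq_trans (subset_leq_card VDD).
rewrite -(leq_exp2l _ _ (prime_gt1 pp)) -oV -oVD.
by apply: subset_leq_card; apply: torsionS.
Qed.

End Span.

(** * The directed diameter of a finite abelian group *)

Section Diameter.

Variable G : finZmodType.

Lemma span_mulrn (T : finType) (u : T -> G) (I : {set T}) p x :
  x \in span u I -> x *+ p \in span (fun t => u t *+ p) I.
Proof.
move=> /spanP[c ->]; apply/spanP; exists c; rewrite -sumrMnl.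
by apply: eq_bigr => t _; rewrite mulrnAC.
Qed.

(** The directed diameter bound sum_i (j_i - 1). Let p be a prime dividing all
    the j_i that are not 1, say |D| of them. Modulo p an element of the span is
    a sum of at most |D| (p - 1) members of the family; the remainder lies in p
    times the span, where induction applies to the family p u and the orders
    j_i / p, at the cost of a factor p in the length. Since
    p (j/p - 1) + (p - 1) = j - 1, the bounds add up. *)
Lemma span_short_sum (T K : finType) (u : T -> G) (I : {set T})
    (b : K -> G) (j : K -> nat) :
    (forall i, 0 < j i)%N -> (forall i i', (j i %| j i') || (j i' %| j i))%N ->
    (forall i, b i *+ j i = 0) -> span u I \subset span b [set: K] ->
  forall x, x \in span u I -> exists2 m : T -> nat,
    (\sum_(t in I) m t <= \sum_i (j i).-1)%N & x = \sum_(t in I) u t *+ m t.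
Proof.
have [N] := ubnP (\sum_i (j i).-1)%N.
elim: N => // N IH in u b j * => ltN j_gt0 j_chain bj0 sub x xI.
pose D := [set i | 1 < j i]%N.
have j1 i : i \notin D -> j i = 1%N.
  by rewrite inE; move: (j_gt0 i); lia.
have b0 i : i \notin D -> b i = 0.
  by move=> iD; rewrite -(bj0 i) j1.
have subD : span u I \subset span b D.
  apply: subset_trans sub _; apply: span_min => [|i _]; first exact: span_closed.
  have [|/b0 ->] := boolP (i \in D); first exact: mem_span.
  by case: (span_closed b D).
have [D0|[i1 Di1]] := set_0Vmem D.
  exists (fun=> 0%N); first by rewrite big1.
  move: (subsetP subD x xI) => /spanP[c ->].
  by rewrite D0 big_set0 big1.
(* The j_i form a chain, so a prime divisor of the least j_i > 1 divides all
   of those. *)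
have [i0 Di0 i0min] := arg_minnP j Di1.
pose p := pdiv (j i0).
have pp : prime p by apply: pdiv_prime; move: (Di0); rewrite [X in is_true X -> _]inE.
have p0 := prime_gt0 pp; have p1 := prime_gt1 pp.
have pD i : i \in D -> (p %| j i)%N.
  move=> Di; case/orP: (j_chain i0 i) => H; first exact: dvdn_trans (pdiv_dvd _) H.
  suff -> : j i = j i0 by apply: pdiv_dvd.
  by apply/eqP; rewrite eqn_leq (i0min i Di) dvdn_leq.
have [V [VI oV rV]] := span_mod_prime_rank pp subD.
pose j' i := if i \in D then (j i %/ p)%N else 1%N.
have jD i : i \in D -> j i = (j' i * p)%N.
  by move=> Di; rewrite /j' Di divnK ?pD.
have j'0 i : (0 < j' i)%N.
  rewrite /j'; case: ifP => // Di; rewrite divn_gt0 //.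
  by apply: dvdn_leq => //; apply: pD.
have [c cp [y yI ->]] := rV x xI.
have sumj : (\sum_i (j i).-1 = p * \sum_i (j' i).-1 + #|D| * p.-1)%N.
  rewrite (bigID (mem D)) /= [X in (_ + X)%N]big1 ?addn0; last first.
    by move=> i iD; rewrite j1.
  rewrite [in RHS](bigID (mem D)) /= [X in (_ * (_ + X))%N]big1 ?addn0; last first.
    by move=> i iD; rewrite /j' (negbTE iD).
  rewrite big_distrr -sum_nat_const -big_split; apply: eq_bigr => i Di.
  by rewrite (jD i Di) /=; move: (j'0 i); case: (j' i) => // k _; nia.
have [||||||m' lem' ->] := IH (fun t => u t *+ p) (fun i => b i *+ p) j' _ _ _ _ _ (y *+ p).
- suff: (0 < #|D| * p.-1)%N.
    move=> H; have : (\sum_i (j' i).-1 <= p * \sum_i (j' i).-1)%N by rewrite leq_pmull.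
    by move: ltN H; rewrite sumj; lia.
  by rewrite muln_gt0 card_gt0; apply/andP; split; [apply/set0Pn; exists i1 | lia].
- exact: j'0.
- move=> i i'; rewrite /j'; case: ifP => Di; last by rewrite dvd1n.
  case: ifP => Di'; last by rewrite dvd1n orbT.
  case/orP: (j_chain i i') => H; apply/orP; [left|right].
    by rewrite -(dvdn_pmul2r p0) !divnK ?pD.
  by rewrite -(dvdn_pmul2r p0) !divnK ?pD.
- move=> i; have [Di|/b0 ->] := boolP (i \in D); last by rewrite !mul0rn.
  by rewrite -mulrnA mulnC -jD.
- apply: span_min => [|t It]; first exact: span_closed.
  by apply: span_mulrn; apply: (subsetP sub); apply: mem_span.
- exact: span_mulrn.
exists (fun t => (t \in V) * c t + p * m' t)%N.
  rewrite big_split /= sumj addnC -big_distrr /=; apply: leq_add.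
    by rewrite leq_mul2l lem' orbT.
  rewrite (bigID (mem V)) /= [X in (_ + X)%N]big1 ?addn0; last first.
    by move=> t /andP[_ /negbTE ->].
  apply: leq_trans (leq_mul oV (leqnn _)); rewrite -sum_nat_const.
  rewrite big_mkcond [X in (_ <= X)%N]big_mkcond; apply: leq_sum => t _.
  case: (t \in V) => /=; rewrite ?andbF //.
  by case: ifP => //; move: (cp t); lia.
have -> : \sum_(t in V) u t *+ c t = \sum_(t in I) u t *+ ((t \in V) * c t).
  rewrite (bigID (mem V) (mem I)) /= [X in _ + X]big1 ?addr0; last first.
    by move=> t /andP[_ /negbTE ->].
  apply: eq_big => t; last by move=> ->; rewrite mul1n.
  by apply/idP/andP => [Vt|[]//]; split=> //; apply: (subsetP VI).
rewrite -big_split; apply: eq_bigr => t _ /=.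
by rewrite mulrnDr -mulrnA.
Qed.

End Diameter.

(** * Subgroups and their localizations; relations among group elements *)

Section Subgroup.

Variables (V : zmodType) (H : set V).
Hypothesis subH : is_subgroup H.

Lemma subgroup0 : H 0. Proof. exact: subH.1. Qed.
Lemma subgroupB x y : H x -> H y -> H (x - y). Proof. exact: subH.2. Qed.
Lemma subgroupN x : H x -> H (- x).
Proof. by move=> Hx; rewrite -sub0r; apply: subgroupB subgroup0 Hx. Qed.
Lemma subgroupD x y : H x -> H y -> H (x + y).
Proof. by move=> Hx Hy; rewrite -[y]opprK; apply: subgroupB Hx (subgroupN Hy). Qed.
Lemma subgroupMn x k : H x -> H (x *+ k).
Proof.
by move=> Hx; elim: k => [|k IH]; rewrite ?mulr0n ?mulrS; [apply: subgroup0 | apply: subgroupD].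
Qed.
Lemma subgroupMz x (z : int) : H x -> H (x *~ z).
Proof. by case: z => k Hx; rewrite ?NegzE ?mulrNz; [|apply: subgroupN]; apply: subgroupMn. Qed.

Lemma subgroup_gcd x m k : (0 < k)%N -> H (x *+ k) -> H (x *+ m) -> H (x *+ gcdn k m).
Proof.
move=> k0 Hk Hm; have [a _ /dvdnP[c e]] := Bezoutl m k0.
have -> : x *+ gcdn k m = x *+ (gcdn k m + a * m) - x *+ (a * m).
  by rewrite mulrnDr addrK.
rewrite e [(a * m)%N]mulnC [(c * k)%N]mulnC !mulrnA.
by apply: subgroupB; apply: subgroupMn.
Qed.

(** The elements of V that fall in H after localization at q. *)
Definition localized q : set V := fun x => exists2 e, ~~ (q %| e)%N & H (x *+ e).

Lemma localized_subgroup q : prime q -> is_subgroup (localized q).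
Proof.
move=> pq; split.
  exists 1%N; last exact: subgroup0.
  by rewrite dvdn1 neq_ltn prime_gt1 ?orbT.
move=> x y [e qe He] [e' qe' He']; exists (e * e')%N; first by rewrite Euclid_dvdM // negb_or qe.
rewrite mulrnBl {2}mulnC !mulrnA; apply: subgroupB; exact: subgroupMn.
Qed.

Lemma sub_localized q x : prime q -> H x -> localized q x.
Proof.
move=> pq Hx; exists 1%N => //.
by rewrite dvdn1 neq_ltn prime_gt1 ?orbT.
Qed.

Lemma localized_sat q x e : prime q -> ~~ (q %| e)%N ->
  localized q (x *+ e) -> localized q x.
Proof.
move=> pq qe [e' qe' He']; exists (e * e')%N; last by rewrite mulrnA.
by rewrite Euclid_dvdM // negb_or qe.
Qed.

(** The multipliers e with e x in H form an ideal of the integers that lies in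
    no prime ideal. *)
Lemma localized_all x : (forall q, prime q -> localized q x) -> H x.
Proof.
move=> Hx; have [e0 qe0 He0] := Hx 2%N isT.
have {qe0} e0_gt0 : (0 < e0)%N by case: e0 qe0 He0.
have [N] := ubnP e0; elim: N => // N IH in e0 e0_gt0 He0 *.
move=> ltN; have [e1|e1] := leqP e0 1.
  by move: He0; have -> : e0 = 1%N by lia.
have pq := pdiv_prime e1; have [e qe He] := Hx _ pq.
apply: (IH (gcdn e0 e)); rewrite ?gcdn_gt0 ?e0_gt0 //; first exact: subgroup_gcd.
rewrite -ltnS; apply: leq_trans ltN; rewrite ltnS ltn_neqAle.
rewrite dvdn_leq ?dvdn_gcdl // andbT; apply: contra qe => /eqP E.
by apply: dvdn_trans (pdiv_dvd _) _; rewrite -E dvdn_gcdr.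
Qed.

End Subgroup.

Section Relations.

Variable G : finZmodType.
Local Notation vec := {ffun G -> int}.

Definition int_sum (x : vec) : G := \sum_g g *~ x g.

Lemma int_sumB x y : int_sum (x - y) = int_sum x - int_sum y.
Proof. by rewrite -sumrB; apply: eq_bigr => g _; rewrite !ffunE mulrzBr. Qed.

Lemma int_sum0 : int_sum 0 = 0.
Proof. by rewrite -[X in int_sum X](subrr 0) int_sumB subrr. Qed.

Lemma int_sumN x : int_sum (- x) = - int_sum x.
Proof. by rewrite -sub0r int_sumB int_sum0 sub0r. Qed.

Lemma int_sumD x y : int_sum (x + y) = int_sum x + int_sum y.
Proof. by rewrite -{1}[y]opprK int_sumB int_sumN opprK. Qed.

Lemma int_sumMn x k : int_sum (x *+ k) = int_sum x *+ k.
Proof. by elim: k => [|k IH]; rewrite ?mulr0n ?int_sum0 // !mulrS int_sumD IH. Qed.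

Lemma int_sumMz x (z : int) : int_sum (x *~ z) = int_sum x *~ z.
Proof. by case: z => k; rewrite ?NegzE ?mulrNz ?int_sumN; [|congr (- _)]; apply: int_sumMn. Qed.

Definition unitv (g : G) : vec := [ffun g' => (g' == g)%:Z].

Lemma int_mulrn (z : int) k : z *+ k = z * k%:Z.
Proof. by rewrite -mulr_natr natz. Qed.

Lemma vecMnE (x : vec) k g : (x *+ k) g = x g *+ k.
Proof. by elim: k => [|k IH]; rewrite ?mulr0n ?ffunE // !mulrS ffunE IH. Qed.

Lemma vecMzE (x : vec) (z : int) g : (x *~ z) g = x g * z.
Proof.
have e k : (x *+ k) g = x g * k%:Z by rewrite vecMnE int_mulrn.
by case: z => k; rewrite ?NegzE ?mulrNz ?ffunE ?mulrN; [|congr (- _)]; apply: e.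
Qed.

Definition relation (I : {set G}) (x : vec) :=
  (forall g, g \notin I -> x g = 0) /\ int_sum x = 0.

Lemma relation_subgroup I : is_subgroup (relation I).
Proof.
split; first by split=> [g _|]; rewrite ?ffunE ?int_sum0.
move=> x y [xI x0] [yI y0]; split=> [g gI|]; last by rewrite int_sumB x0 y0 subr0.
by rewrite !ffunE xI // yI // subr0.
Qed.

Lemma int_sum_sub (I : {set G}) (x : vec) : (forall g, g \notin I -> x g = 0) ->
  int_sum x = \sum_(g in I) g *~ x g.
Proof.
move=> xI; rewrite /int_sum (bigID (mem I)) /= [X in _ + X]big1 ?addr0 // => g gI.
by rewrite xI.
Qed.

Lemma span_mulz (I : {set G}) h (x : vec) : (forall g, g \notin I -> x g = 0) ->
  int_sum x *+ h \in span (fun g => g *+ h) I.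
Proof.
move=> xI; rewrite (int_sum_sub xI) -sumrMnl.
have cS := span_closed (fun g : G => g *+ h) I.
apply: add_closed_sum => // g gI.
have -> : g *~ x g *+ h = g *+ h *~ x g by rewrite !pmulrn mulrzAC.
have gS := mem_span (fun g : G => g *+ h) gI.
case: (x g) => k; first exact: add_closedMn.
rewrite NegzE mulrNz -sub0r; apply: add_closedB => //; first exact: cS.1.
exact: add_closedMn.
Qed.

Section Local.

Variables (q : nat) (H : set vec) (I : {set G}).
Hypotheses (pq : prime q) (subH : is_subgroup H).
Hypothesis satH : forall x e, ~~ (q %| e)%N -> H (x *+ e) -> H x.
Hypothesis IH : forall I' : {set G}, I' \proper I ->
  forall x, relation I' x -> H x.
Hypothesis I_gt1 : (1 < #|I|)%N.

(** Up to a multiplier prime to q, the j-th coordinate becomes a multiple of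
    |G|; subtracting a multiple of the relation |G| j = 0 removes it. Both the
    result and that relation have a smaller support. *)
Lemma relation_coord_dvd x j : relation I x -> j \in I ->
  ((partn #|G| q)%:Z %| x j)%Z -> H x.
Proof.
move=> [xI x0] jI /dvdzP[z ez].
have G0 : (0 < #|G|)%N by apply/card_gt0P; exists 0.
have ndiv : ~~ (q %| partn #|G| q^')%N.
  rewrite -prime_coprime // -[X in coprime X](part_pnat_id (pnat_id pq)).
  by apply: coprime_partC.
apply: (satH ndiv).
have pJ : [set j] \proper I by rewrite properEcard sub1set jI cards1.
have Hj : H (unitv j *+ #|G|).
  apply: (IH pJ); split=> [g|]; last by rewrite int_sumMn mulrn_card.
  by rewrite inE vecMnE ffunE => /negbTE ->; rewrite mul0rn.
rewrite -(subrK (unitv j *+ #|G| *~ z) (x *+ _)).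
apply: subgroupD => //; last exact: subgroupMz.
apply: (IH (properD1 jI)); split=> [g|]; last first.
  by rewrite int_sumB int_sumMz !int_sumMn x0 mulrn_card mul0rn mul0rz subrr.
rewrite !inE negb_and negbK !ffunE vecMzE !vecMnE ffunE => /orP[/eqP -> | gI].
  move: ez (partnC q G0); generalize (partn #|G| q) (partn #|G| q^') => Q e' ez eN.
  by rewrite eqxx ez -eN !int_mulrn PoszM -[Posz true]/(1%:R : int); ring.
case: eqP => [gj|_]; first by rewrite gj jI in gI.
by rewrite xI // !mul0rn mul0r subr0.
Qed.

(** Let u_g = hg. Iterating the hypothesis on V expresses every element of the
    span of u through V modulo any power of q. Choose i and j in I outside V.
    For i this gives a relation h rho in which rho_i is 1, and rho_j is 0,
    modulo the q-part of |G|. The coordinate j shows that h rho is in H; the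
    coordinate i shows that x h - x_i (h rho) is in H. *)
Lemma relation_mul (V : {set G}) h x :
    V \subset I -> (#|V| + 2 <= #|I|)%N ->
    (forall a, a \in span (fun g => g *+ h) I -> exists c : G -> nat,
      exists2 y, y \in span (fun g => g *+ h) I &
        a = \sum_(t in V) t *+ h *+ c t + y *+ q) ->
  relation I (x *+ h) -> H (x *+ h).
Proof.
move=> VI oV rV Rx; set u := fun g : G => g *+ h.
have rVk k a : a \in span u I -> exists c : G -> nat,
      exists2 y, y \in span u I & a = \sum_(t in V) u t *+ c t + y *+ (q ^ k).
  move=> aI; elim: k => [|k [c [y yI ->]]].
    by exists (fun=> 0%N), a => //; rewrite expn0 mulr1n big1 ?add0r.
  have [c' [y' y'I ->]] := rV y yI.
  exists (fun t => (c t + c' t * q ^ k)%N), y' => //.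
  rewrite mulrnDl addrA -mulrnA -expnS; congr (_ + _).
  rewrite -sumrMnl -big_split; apply: eq_bigr => t _.
  by rewrite mulrnDr mulrnA.
have oD : (1 < #|I :\: V|)%N.
  have := cardsID V I; rewrite (setIidPr VI); lia.
have [i /setDP[iI iV]] : exists i, i \in I :\: V.
  by apply/set0Pn; rewrite -card_gt0; lia.
have [j] : exists j, j \in (I :\: V) :\ i.
  by apply/set0Pn; rewrite -card_gt0; move: oD; rewrite (cardsD1 i) inE iV iI.
rewrite !inE => /and3P[ji jV jI].
have [c [w /spanP[z ez] ei]] := rVk (logn q #|G|) _ (mem_span u iI).
rewrite -p_part in ei; set Q := partn #|G| q in ei.
(* i - sum_(t in V) c_t t - Q z, where hi = sum_(t in V) c_t (ht) + Q (hz) *)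
pose rho : vec := [ffun g => (g == i)%:Z - ((g \in V) * c g)%N%:Z - ((g \in I) * (z g * Q))%N%:Z].
have rhoI g : g \notin I -> rho g = 0.
  move=> gI; rewrite ffunE (negbTE gI).
  case: eqP => [gi|_]; first by rewrite -gi (negbTE gI) in iI.
  by case: (boolP (g \in V)) => // /(subsetP VI); rewrite (negbTE gI).
have Rrho : relation I (rho *+ h).
  split=> [g gI|]; first by rewrite vecMnE rhoI ?mul0rn.
  rewrite int_sumMn (int_sum_sub rhoI) -sumrMnl.
  under eq_bigr => g gI.
    rewrite ffunE gI mul1n !mulrzBr !mulrnBl.
    over.
  rewrite !sumrB.
  rewrite (bigD1 i iI) /= eqxx big1 ?addr0 => [|g /andP[_ /negbTE ->]]; last first.
    by rewrite mulr0z mul0rn.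
  have -> : \sum_(g in I) g *~ ((g \in V) * c g)%N *+ h = \sum_(t in V) u t *+ c t.
    rewrite (big_setID V) /= (setIidPr VI) [X in _ + X]big1 ?addr0 => [|g]; last first.
      by rewrite inE => /andP[/negbTE -> _]; rewrite mulr0z mul0rn.
    by apply: eq_bigr => g ->; rewrite mul1n mulrnAC.
  have -> : \sum_(g in I) g *~ (z g * Q)%N *+ h = w *+ Q.
    rewrite ez -sumrMnl; apply: eq_bigr => g _.
    by rewrite -pmulrn /u -!mulrnA mulnC.
  by rewrite /= mulr1z -[i *+ h]/(u i) ei addrAC addrK subrr.
have Hrho : H (rho *+ h).
  apply: (relation_coord_dvd Rrho jI); rewrite vecMnE ffunE (negbTE ji) (negbTE jV).
  apply/dvdzP; exists (- (z j)%:Z * h%:Z).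
  by rewrite jI mul0n mul1n int_mulrn PoszM /=; ring.
rewrite -(subrK (rho *+ h *~ x i) (x *+ h)).
apply: subgroupD => //; last exact: subgroupMz.
apply: (relation_coord_dvd _ iI).
  apply: subgroupB => //; first exact: relation_subgroup.
  by apply: subgroupMz => //; exact: relation_subgroup.
rewrite !ffunE vecMzE !vecMnE ffunE eqxx (negbTE iV) iI mul1n mul0n PoszM.
apply/dvdzP; exists (x i * (z i)%:Z * h%:Z).
by rewrite /= !int_mulrn; ring.
Qed.

End Local.
End Relations.

(** * Zero-sum sequences replacing a relation *)

Section Halve.

Variable G : finZmodType.
Local Notation vec := {ffun G -> int}.

Lemma int_sum_to_quotient (S : sequence G) : int_sum (to_quotient S) = seq_sum S.
Proof. by apply: eq_bigr => g _; rewrite ffunE. Qed.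

(** Division with remainder by h writes x = f + h m0. The quotient m0 of x and
    the quotient of -x (whose remainders are h - f_g, or 0 where f_g = 0) are
    replaced by short nonnegative combinations with the same image in G. The
    resulting sequences S1 and S2 agree with x and -x modulo relations divisible
    by h, and at each element of I their remainders add up to at most h; hence
    one of them has length at most d. *)
Lemma relation_halve (H : set vec) (I : {set G}) h D d x :
    is_subgroup H -> (0 < h)%N ->
    (forall S : sequence G, seq_supp S \subset I -> seq_sum S = 0 ->
       (seq_length S <= d)%N -> H (to_quotient S)) ->
    (forall a, a \in span (fun g => g *+ h) I -> exists2 m : G -> nat,
       (\sum_(g in I) m g <= D)%N & a = \sum_(g in I) g *+ h *+ m g) ->
    (forall x, relation I (x *+ h) -> H (x *+ h)) ->
    (#|I| * h + 2 * (h * D) <= (2 * d).+1)%N ->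
  relation I x -> H x.
Proof.
move=> subH h0 Hsmall Hspan Hmul bound [xI x0].
pose f g := `|(x g %% h)%Z|%N; pose m0 : vec := [ffun g => (x g %/ h)%Z].
have hz : h%:Z != 0 by case: (h) h0.
have ef g : x g = m0 g * h%:Z + (f g)%:Z.
  by rewrite ffunE /f gez0_abs ?modz_ge0 // -divz_eq.
have ltf g : (f g < h)%N.
  by rewrite -ltz_nat /f gez0_abs ?modz_ge0 // ltz_pmod // ltz_nat.
have f0 g : g \notin I -> f g = 0%N by move=> /xI; rewrite /f => ->; rewrite mod0z.
have m00 g : g \notin I -> m0 g = 0 by move=> /xI; rewrite ffunE => ->; rewrite div0z.
clearbody f m0.
(* n1 is the quotient of -x by h. *)
pose n1 : vec := [ffun g => - (m0 g + (f g != 0%N)%:Z)].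
have n10 g : g \notin I -> n1 g = 0 by move=> gI; rewrite ffunE f0 // m00.
pose ext (m : G -> nat) : vec := [ffun g => ((g \in I) * m g)%N%:Z].
have ext0 m g : g \notin I -> ext m g = 0 by move=> /negbTE gI; rewrite ffunE gI.
have int_sum_ext m : int_sum (ext m) *+ h = \sum_(g in I) g *+ h *+ m g.
  rewrite (int_sum_sub (ext0 m)) -sumrMnl; apply: eq_bigr => g gI.
  by rewrite ffunE gI mul1n mulrnAC.
have [m lem em] := Hspan _ (span_mulz h m00).
have [m' lem' em'] := Hspan _ (span_mulz h n10).
pose S1 : sequence G := [ffun g => ((g \in I) * (f g + h * m g))%N].
pose S2 : sequence G :=
  [ffun g => ((g \in I) * ((f g != 0%N) * (h - f g) + h * m' g))%N].
have R1 : relation I ((m0 - ext m) *+ h).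
  split; last by rewrite int_sumMn int_sumB mulrnBl int_sum_ext em subrr.
  by move=> g gI; rewrite vecMnE !ffunE m00 // (negbTE gI) subrr mul0rn.
have R2 : relation I ((ext m' - n1) *+ h).
  split; last by rewrite int_sumMn int_sumB mulrnBl int_sum_ext em' subrr.
  by move=> g gI; rewrite vecMnE [X in X *+ _]ffunE ext0 // [X in _ + X]ffunE n10 // subrr mul0rn.
have e1 : to_quotient S1 = x - (m0 - ext m) *+ h.
  apply/ffunP => g; rewrite !ffunE vecMnE !ffunE.
  have [gI|gI] := boolP (g \in I); last first.
    by rewrite xI // m00 // !mul0n !subr0 mul0rn.
  by rewrite (ef g) !mul1n PoszD PoszM int_mulrn; ring.
have e2 : to_quotient S2 = (ext m' - n1) *+ h - x.
  apply/ffunP => g; rewrite !ffunE vecMnE !ffunE.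
  have [gI|gI] := boolP (g \in I); last first.
    by rewrite f0 // xI // m00 // !mul0n /= oppr0 !subr0 mul0rn.
  rewrite (ef g) !mul1n int_mulrn.
  have [-> | fn0] := eqVneq (f g) 0%N.
    by rewrite mul0n add0n PoszM /=; ring.
  have eh : (h - f g)%N%:Z = h%:Z - (f g)%:Z by rewrite subzn // ltnW.
  by rewrite /= mul1n PoszD PoszM eh; ring.
have suppS1 : seq_supp S1 \subset I.
  by apply/subsetP => g; rewrite inE ffunE; case: (g \in I).
have suppS2 : seq_supp S2 \subset I.
  by apply/subsetP => g; rewrite inE ffunE; case: (g \in I).
have sum1 : seq_sum S1 = 0.
  by rewrite -int_sum_to_quotient e1 int_sumB x0 R1.2 subrr.
have sum2 : seq_sum S2 = 0.
  by rewrite -int_sum_to_quotient e2 int_sumB x0 R2.2 subrr.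
have len : (seq_length S1 + seq_length S2 <= (2 * d).+1)%N.
  apply: leq_trans bound; rewrite -big_split /=.
  have -> : (\sum_g (S1 g + S2 g) = \sum_(g in I) (S1 g + S2 g))%N.
    rewrite [LHS](bigID (mem I)) /= [X in (_ + X)%N]big1 ?addn0 // => g gI.
    by rewrite !ffunE (negbTE gI).
  apply: (@leq_trans (\sum_(g in I) (h + h * m g + h * m' g))%N).
    apply: leq_sum => g gI; rewrite !ffunE gI !mul1n.
    by have := ltf g; case: eqP; lia.
  rewrite !big_split /= sum_nat_const -!big_distrr /= -addnA.
  by rewrite leq_add2l mul2n -addnn; apply: leq_add; rewrite leq_mul2l ?lem ?lem' orbT.
have [le1|le1] := leqP (seq_length S1) d.
  rewrite -(subrK ((m0 - ext m) *+ h) x).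
  by apply: subgroupD => //; [rewrite -e1; apply: Hsmall | apply: Hmul].
have -> : x = (ext m' - n1) *+ h - to_quotient S2 by rewrite e2 opprB addrC subrK.
apply: subgroupB => //; first exact: Hmul.
by apply: Hsmall => //; lia.
Qed.

End Halve.

(** * Generation of all relations by short zero-sum sequences *)

Section RelationsGenerated.

Variables (G : finZmodType) (r : nat) (n : 'I_r -> nat) (b : 'I_r -> G).
Hypothesis n_gt0 : forall i, (0 < n i)%N.
Hypothesis n_chain : forall i j : 'I_r, (i <= j)%N -> (n i %| n j)%N.
Hypothesis b_ord : forall i, b i *+ n i = 0.
Hypothesis b_gen : forall g : G, exists c : 'I_r -> nat, g = \sum_i b i *+ c i.
Local Notation vec := {ffun G -> int}.

Variables (q : nat) (H : set vec) (G0 : {set G}) (d : nat).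
Hypotheses (pq : prime q) (subH : is_subgroup H).
Hypothesis satH : forall x e, ~~ (q %| e)%N -> H (x *+ e) -> H x.
Hypothesis small : forall S : sequence G, seq_supp S \subset G0 ->
  seq_sum S = 0 -> (seq_length S <= d)%N -> H (to_quotient S).
Hypothesis n_le_d : forall i, (n i <= d)%N.
Hypothesis card_le : (#|G0| <= r)%N.
Hypothesis d_large : forall k (c : 'I_r), (1 < k <= r)%N -> (c + uphalf k = r)%N ->
  (k * n c + 2 * \sum_(i : 'I_r | c < i) (n i - n c) <= (2 * d).+1)%N.

(** A relation supported on one element g is a multiple of #[g] g = 0, and #[g]
    divides the largest invariant. *)
Lemma relation_singleton g x : g \in G0 -> relation [set g] x -> H x.
Proof.
move=> gG0 [xI x0].
have xg' g' : g' != g -> x g' = 0 by move=> e; apply: xI; rewrite inE.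
have G0_gt0 : (0 < #|G0|)%N by apply/card_gt0P; exists g.
have r0 : (0 < r)%N by apply: leq_trans card_le.
have lt_r : (r.-1 < r)%N by rewrite prednK.
pose m := n (Ordinal lt_r).
have gm : g *+ m = 0.
  have [c ->] := b_gen g; rewrite -sumrMnl big1 // => i _.
  have /dvdnP[k e] : (n i %| m)%N by apply: n_chain => /=; rewrite -ltnS prednK.
  by rewrite e mulnC mulrnAC mulrnA b_ord !mul0rn.
have [z ez] : exists z : int, x g = z * (#[g]%g)%:Z.
  apply/dvdzP; rewrite dvdzE absz_nat order_dvdn FinRing.zmodXgE.
  move: x0; rewrite (int_sum_sub xI) big_set1; case: (x g) => k; first by rewrite -pmulrn => /eqP.
  by rewrite NegzE abszN absz_nat mulrNz -pmulrn => /eqP; rewrite oppr_eq0.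
pose S : sequence G := [ffun g' => ((g' == g) * #[g]%g)%N].
have -> : x = to_quotient S *~ z.
  apply/ffunP => g'; rewrite vecMzE !ffunE; case: eqVneq => [->|/xg' ->].
    by rewrite mul1n ez mulrC.
  by rewrite mul0n mul0r.
apply: subgroupMz => //; apply: small.
- by apply/subsetP => g'; rewrite inE ffunE; case: eqP => // ->.
- rewrite /seq_sum (bigD1 g) //= ffunE eqxx mul1n big1.
    by rewrite addr0 -FinRing.zmodXgE expg_order.
  by move=> g' /negbTE e; rewrite ffunE e.
rewrite /seq_length (bigD1 g) //= ffunE eqxx mul1n big1 => [|g' /negbTE e]; last first.
  by rewrite ffunE e.
rewrite addn0; apply: leq_trans (n_le_d (Ordinal lt_r)).
by apply: dvdn_leq => //; rewrite order_dvdn FinRing.zmodXgE gm.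
Qed.

(** The index c is chosen so that hG, with h = n c, is generated by
    r - c - 1 = uphalf #|I| - 1 elements: few enough for [relation_mul], which
    wants at most #|I| - 2, and many enough for the box of side h in
    [relation_halve] to be short. *)
Lemma relation_generated (I : {set G}) x : I \subset G0 -> relation I x -> H x.
Proof.
have [N] := ubnP #|I|; elim: N => // N IH in I x * => ltN sIG Rx.
have [I0|I_gt0] := posnP #|I|.
  suff -> : x = 0 by apply: subgroup0.
  apply/ffunP => g; rewrite ffunE; apply: Rx.1.
  by rewrite (cards0_eq I0) inE.
have [I_le1|I_gt1] := leqP #|I| 1.
  have /cards1P[g eI] : #|I| == 1%N by rewrite eqn_leq I_le1.
  apply: (@relation_singleton g); last by rewrite -eI.
  by apply: (subsetP sIG); rewrite eI inE.
have k_le : (#|I| <= r)%N by apply: leq_trans card_le; apply: subset_leq_card.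
have half_le : (0 < uphalf #|I| <= r)%N.
  by have := uphalf_half #|I|; have := odd_double_half #|I|; lia.
have lt_c : (r - uphalf #|I| < r)%N by lia.
pose c := Ordinal lt_c; pose h := n c; have h0 : (0 < h)%N by apply: n_gt0.
have ec : (c + uphalf #|I| = r)%N by rewrite /= subnK; lia.
pose j (i : 'I_r) := if (c < i)%N then (n i %/ h)%N else 1%N.
pose D := [set i : 'I_r | (c < i)%N].
pose u (g : G) := g *+ h.
have jD (i : 'I_r) : (c < i)%N -> n i = (j i * h)%N.
  by move=> ci; rewrite /j ci divnK // n_chain // ltnW.
have j0 i : (0 < j i)%N.
  have [ci|ci] := boolP (c < i)%N; last by rewrite /j (negbTE ci).
  by move: (n_gt0 i); rewrite (jD i ci) muln_gt0 => /andP[].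
(* The orders n_i with i <= c divide h, so those factors disappear in hG. *)
have b0 (i : 'I_r) : ~~ (c < i)%N -> b i *+ h = 0.
  rewrite -leqNgt => /n_chain/dvdnP[m e].
  by rewrite /h e mulnC mulrnA b_ord mul0rn.
have cD : (#|D| + 2 <= #|I|)%N.
  have -> : #|D| = (r - c.+1)%N.
    rewrite cardsE -sum1_card big_mkcond /=.
    rewrite -(big_mkord xpredT (fun i => if (c < i)%N then 1%N else 0%N)).
    rewrite (@big_cat_nat _ _ _ c.+1) //= big_nat big1 ?add0n => [|i]; last first.
      by move=> /andP[_]; rewrite ltnS leqNgt; case: ifP.
    rewrite big_nat (eq_bigr (fun=> 1%N)) -?big_nat ?sum_nat_const_nat ?muln1 //.
    by move=> i /andP[->].
  by move: ec; have := uphalf_half #|I|; have := odd_double_half #|I|; lia.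
have sub : span u I \subset span (fun i => b i *+ h) D.
  apply: span_min => [|g _]; first exact: span_closed.
  have [a eg] := b_gen g; rewrite /u eg -sumrMnl.
  apply: add_closed_sum => [|i _]; first exact: span_closed.
  rewrite mulrnAC; apply: add_closedMn; first exact: span_closed.
  have [ci|/b0 ->] := boolP (c < i)%N; first by apply: (mem_span (fun i => b i *+ h)); rewrite inE.
  by case: (span_closed (fun i => b i *+ h) D).
apply: (@relation_halve _ H I h (\sum_i (j i).-1)%N d) => //.
- by move=> S sS; apply: small; apply: subset_trans sIG.
- apply: (@span_short_sum _ _ _ u I (fun i => b i *+ h) j) => //.
  + move=> i i'; have [ci|ci] := boolP (c < i)%N; last first.
      by rewrite /j (negbTE ci) dvd1n.
    have [ci'|ci'] := boolP (c < i')%N; last first.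
      by rewrite {2}/j [in X in _ || X]/j (negbTE ci') dvd1n orbT.
    rewrite -(dvdn_pmul2r h0) -(@dvdn_pmul2r h (j i')) // -!jD //.
    by case/orP: (leq_total i i') => /n_chain ->; rewrite ?orbT.
  + move=> i; have [ci|/b0 ->] := boolP (c < i)%N; last by rewrite mul0rn.
    by rewrite -mulrnA mulnC -jD.
  apply: subset_trans sub _; apply: span_min; first exact: span_closed.
  by move=> i _; apply: mem_span; rewrite inE.
- move=> y Ry; have [V [VI oV rV]] := span_mod_prime_rank pq sub.
  apply: (@relation_mul _ q H I pq subH satH _ I_gt1 V h) => //.
  + move=> I' pI' z Rz; apply: (IH I') => //; last first.
      exact: subset_trans (proper_sub pI') sIG.
    by have := proper_card pI'; lia.
  + by apply: leq_trans cD; rewrite leq_add2r.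
  by move=> a /rV[e _ [w wI ->]]; exists e, w.
have k_bd : (1 < #|I| <= r)%N by rewrite I_gt1.
apply: leq_trans (d_large k_bd ec); rewrite leq_add2l leq_mul2l /=.
rewrite big_distrr [X in (_ <= X)%N]big_mkcond /=; apply: leq_sum => i _.
have [ci|ci] := boolP (c < i)%N; last by rewrite /j (negbTE ci) muln0.
by rewrite [in X in (_ <= X)%N](jD i ci) -/h -subn1 mulnBr muln1 mulnC.
Qed.

End RelationsGenerated.

(** * Cyclic decompositions *)

Section CyclicBasis.

Variables (G : finZmodType) (r : nat) (n : 'I_r -> nat).
Hypothesis n_gt1 : forall i, (1 < n i)%N.
Hypothesis hG : [set: G] \isog [set: {dffun forall i : 'I_r, 'Z_(n i)}].

Lemma isog_coordinates :
  exists2 f : G -> {dffun forall i : 'I_r, 'Z_(n i)}, bijective f &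
    forall x y i, f (x + y) i = f x i + f y i.
Proof.
have [f injf imf] := isogP hG; exists f.
  have inj : injective f.
    by move=> x y; move/injmP: injf => H; apply: H; rewrite inE.
  by apply: (inj_card_bij inj); rewrite -!cardsT -imf card_injm.
move=> x y i.
have -> : f (x + y) = (f x * f y)%g by rewrite -morphM ?inE.
by rewrite dffunM.
Qed.

Lemma cyclic_basis :
  exists f : G -> forall i : 'I_r, 'Z_(n i), exists b : 'I_r -> G,
  [/\ forall x y i, f (x + y) i = f x i + f y i,
      forall i j, f (b i) j = (i == j)%:R,
      forall i, b i *+ n i = 0
    & forall g, g = \sum_i b i *+ f g i].
Proof.
have [f [f' fK f'K] fD] := isog_coordinates.
have f0 i : f 0 i = 0 by apply: (addrI (f 0 i)); rewrite -fD !addr0.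
have fM x k i : f (x *+ k) i = f x i *+ k.
  by elim: k => [|k IH]; rewrite ?mulr0n // !mulrS fD IH.
have fS (F : 'I_r -> G) i : f (\sum_j F j) i = \sum_j f (F j) i.
  by rewrite (big_morph (fun x => f x i) (fun x y => fD x y i) (f0 i)).
have finj : forall x y, (forall i, f x i = f y i) -> x = y.
  by move=> x y e; apply: (can_inj fK); apply/ffunP.
(* The standard basis of the product. *)
pose e i : {dffun forall i : 'I_r, 'Z_(n i)} := [ffun j => (i == j)%:R].
have fe i j : f (f' (e i)) j = (i == j)%:R by rewrite f'K ffunE.
have ncast i : (Zp_trunc (n i)).+2 = n i by apply: Zp_cast.
exists f, (fun i => f' (e i)); split=> // [i|g].
  apply: finj => j; rewrite fM fe f0; case: eqVneq => [<-|_]; last first.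
    by rewrite mul0rn.
  by rewrite pchar_Zp.
apply: finj => j; rewrite fS (bigD1 j) //= big1 ?addr0 => [|i ij].
  by rewrite fM fe eqxx natr_Zp.
by rewrite fM fe (negbTE ij) mul0rn.
Qed.

End CyclicBasis.

(** * Diagonal modules *)

Section DiagonalModule.

Variables (R : realType) (G : finZmodType) (m : nat).
Local Notation C := R[i].
Variable chi : 'I_m -> G -> C.
Hypothesis chi0 : forall i, chi i 0 = 1.
Hypothesis chiD : forall i x y, chi i (x + y) = chi i x * chi i y.

Definition diag_repr (g : G) : 'M[C]_m := diag_mx (\row_i chi i g).

Lemma diag_reprP : mx_repr [set: G] diag_repr.
Proof.
split=> [|x y _ _].
  apply/matrixP => i j; rewrite !mxE FinRing.zmod1gE chi0.
  by case: eqP => // ->.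
rewrite /diag_repr mul_diag_mx; apply/matrixP => i j; rewrite !mxE.
by rewrite FinRing.zmodMgE chiD mulrnAr.
Qed.

Definition diag_rep := MxRepresentation diag_reprP.

Lemma diag_repE g u i : (diag_rep g *m u) i ord0 = chi i g * u i (ord0 : 'I_1).
Proof. by rewrite /= /diag_repr mul_diag_mx !mxE. Qed.

Definition chi_mon (a : 'I_m -> nat) g := \prod_i chi i g ^+ a i.

Lemma chi_monD a x y : chi_mon a (x + y) = chi_mon a x * chi_mon a y.
Proof. by rewrite -big_split; apply: eq_bigr => i _; rewrite chiD exprMn. Qed.

Lemma sum_character_eq0 a g0 : chi_mon a g0 <> 1 -> \sum_g chi_mon a g = 0.
Proof.
move=> ne1; have : (chi_mon a g0 - 1) * \sum_g chi_mon a g = 0.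
  rewrite mulrBl mul1r big_distrr /=.
  rewrite [X in _ - X](reindex_inj (addrI g0)) /=.
  by under [X in _ - X]eq_bigr do rewrite chi_monD; rewrite subrr.
by move/eqP; rewrite mulf_eq0 subr_eq0 => /orP[/eqP|/eqP].
Qed.

(** Averaging an invariant polynomial over the group kills the monomials on
    which the group acts by a nontrivial character. Working with values at u
    avoids proving that the other coefficients vanish. *)
Lemma invariant_poly_average f u : invariant_poly diag_rep f ->
  #|G|%:R * poly_at f u =
    \sum_(a <- msupp f) f@_a * (\prod_i u i ord0 ^+ a i * \sum_g chi_mon a g).
Proof.
move=> inv; transitivity (\sum_(g : G) poly_at f (diag_rep g *m u)).
  under eq_bigr do rewrite inv ?inE //.
  by rewrite sumr_const mulr_natl.
rewrite /poly_at; under eq_bigr do rewrite mevalE.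
rewrite exchange_big /=; apply: eq_bigr => a _.
rewrite -big_distrr /=; congr (_ * _); rewrite big_distrr; apply: eq_bigr => g _.
rewrite -[RHS]big_split; apply: eq_bigr => i _.
by rewrite diag_repE exprMn mulrC.
Qed.

(** The points (1, ..., 1) and w have different orbits, but all invariant
    monomials of degree at most d take the value 1 at both. *)
Lemma not_separated_in_degree (w : 'I_m -> C) d :
    (forall g, exists i, chi i g <> w i) ->
    (forall a : 'I_m -> nat, (\sum_i a i <= d)%N -> (forall g, chi_mon a g = 1) ->
       \prod_i w i ^+ a i = 1) ->
  ~ separated_in_degree R [set: G]%G d.
Proof.
move=> w_orb w_mon sep; have [S [Sinv Ssep] Sdeg] := sep m diag_rep.
pose v0 : 'cV[C]_m := const_mx 1; pose w0 : 'cV[C]_m := \col_i w i.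
have [|f Sf []] := Ssep v0 w0.
  move=> e; have : module_orbit diag_rep w0 w0.
    by exists 1%g; rewrite ?inE // repr_mx1 mul1mx.
  rewrite -e => -[g _ /matrixP eg]; have [i []] := w_orb g.
  by have := eg i ord0; rewrite diag_repE !mxE mulr1.
have inv := Sinv f Sf.
have G0 : #|G|%:R != 0 :> C.
  by rewrite Num.Theory.pnatr_eq0 -lt0n; apply/card_gt0P; exists 0.
apply: (mulfI G0); rewrite !invariant_poly_average //.
apply: eq_big_seq => a af; congr (_ * _).
have [triv|/existsNP[g0 /sum_character_eq0 ->]] := pselect (forall g, chi_mon a g = 1); last first.
  by rewrite !mulr0.
congr (_ * _); rewrite big1 => [|i _]; last by rewrite mxE expr1n.
under [RHS]eq_bigr do rewrite mxE.
rewrite w_mon // -mdegE -ltnS; apply: leq_trans (Sdeg f Sf).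
exact: msize_mdeg_lt.
Qed.

End DiagonalModule.

(** * A module needing invariants of large degree *)

Lemma prim_root_exists (F : numClosedFieldType) k :
  (k > 0)%N -> exists z : F, k.-primitive_root z.
Proof.
pose p : {poly F} := 'X^k - 1; have [s Dp] := closed_field_poly_normal p.
move=> k_gt0; rewrite (monicP _) ?monicXnsubC // scale1r in Dp.
have rn1: all k.-unity_root s by apply/allP=> z; rewrite -root_prod_XsubC -Dp.
have sz_s: (k < (size s).+1)%N.
  by rewrite -(size_prod_XsubC s id) -Dp size_XnsubC.
have [|z] := hasP (has_prim_root k_gt0 rn1 _ sz_s); last by exists z.
rewrite -separable_prod_XsubC -Dp separable_Xn_sub_1 //.
by rewrite Num.Theory.pnatr_eq0 -lt0n.
Qed.

(** Padding by 1 lets the two parities of r share one module: for even r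
    the condition modulo n_(2l) on the last pair of coordinates is then void. *)
Definition extend_by_1 r (n : 'I_r -> nat) (i : nat) : nat := oapp n 1%N (insub i).

Lemma extend_by_1E r (n : 'I_r -> nat) (i : 'I_r) : extend_by_1 n i = n i.
Proof. by rewrite /extend_by_1 valK. Qed.

Lemma extend_by_1_out r (n : 'I_r -> nat) i : (r <= i)%N -> extend_by_1 n i = 1%N.
Proof. by move=> ri; rewrite /extend_by_1 insubF // ltnNge ri. Qed.

(** The characters theta_i and elements e_i attached to a decomposition into
    cyclic factors: theta_i sends e_i to a primitive root of unity of order n_i
    and is trivial on the other e_j. *)
Lemma dual_characters (R : realType) (G : finZmodType) r (n : 'I_r -> nat)
    (n_gt1 : forall i, (1 < n i)%N)
    (hG : [set: G] \isog [set: {dffun forall i : 'I_r, 'Z_(n i)}]) :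
  exists theta : nat -> G -> R[i], exists e : nat -> G,
  [/\ forall i, theta i 0 = 1,
      forall i x y, theta i (x + y) = theta i x * theta i y,
      forall i k, theta i (e i) ^+ k = 1 -> (extend_by_1 n i %| k)%N
    & forall i j, i != j -> theta i (e j) = 1].
Proof.
have [f [b [fD fb _ _]]] := cyclic_basis n_gt1 hG.
have f0 i : f 0 i = 0 by apply: (addrI (f 0 i)); rewrite -fD !addr0.
have n_gt0 i : (0 < n i)%N by apply: ltnW.
have [omega omegaP] : exists omega : 'I_r -> R[i], forall i, (n i).-primitive_root (omega i).
  exists (fun i => xchoose (prim_root_exists R[i] (n_gt0 i))) => i.
  exact: xchooseP.
have ncast i : (Zp_trunc (n i)).+2 = n i by apply: Zp_cast.
exists (fun i g => if insub i is Some j then omega j ^+ f g j else 1).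
exists (fun i => if insub i is Some j then b j else 0).
split=> [i|i x y|i k|i j ij].
- by case: insubP => // j _ _; rewrite f0.
- case: insubP => [j _ _|_]; last by rewrite mulr1.
  by rewrite fD -exprD -(prim_expr_mod (omegaP j) (_ + _)%N) /= [X in (_ %% X)%N]ncast.
- rewrite /extend_by_1; case: insubP => [j _ _ /=|_ _]; last by rewrite dvd1n.
  rewrite fb eqxx => /eqP; rewrite -exprM -(prim_order_dvd (omegaP j)).
  suff -> : ((1%:R : 'Z_(n j)) : nat) = 1%N by rewrite mul1n.
  by [].
case: insubP => // i' _ ei; case: insubP => [j' _ ej|_]; last by rewrite f0.
rewrite fb; case: eqVneq => // e.
by rewrite -ei -ej e eqxx in ij.
Qed.

Section LongModule.

Variables (R : realType) (G : finZmodType) (l q : nat) (n : nat -> nat).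
Variables (theta : nat -> G -> R[i]) (e : nat -> G).
Hypothesis pq : prime q.
Hypothesis q_dvd : forall i, (i < l)%N -> (q %| n i)%N.
Hypothesis n_gt0 : forall i, (0 < n i)%N.
Hypothesis theta0 : forall i, theta i 0 = 1.
Hypothesis thetaD : forall i x y, theta i (x + y) = theta i x * theta i y.
Hypothesis theta_e : forall i k, theta i (e i) ^+ k = 1 -> (n i %| k)%N.
Hypothesis theta_ne : forall i j, i != j -> theta i (e j) = 1.

(** A character of order q, for i < l. *)
Let kappa i g := theta i g ^+ (n i %/ q).

(** The factors [kappa i] in the characters of X_i and, with exponent q - 1, of
    X_l force the exponents of X_i and X_l to agree modulo q. *)
Let link (i : nat) g :=
  if (i < l)%N then kappa i g else \prod_(j < l) kappa j g ^+ q.-1.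

(** Left indices are the coordinates X_i, right indices the coordinates Y_i. *)
Let chi (k : 'I_(l.+1 + l.+1)) (g : G) : R[i] :=
  match split k with
  | inl i => theta (l + i) g * link i g
  | inr i => theta (l + i) g
  end.

Let chi0 k : chi k 0 = 1.
Proof.
have kappa0 i : kappa i 0 = 1 by rewrite /kappa theta0 expr1n.
rewrite /chi; case: split => i; rewrite theta0 // mul1r /link.
by case: ifP => // _; rewrite big1 // => j _; rewrite kappa0 expr1n.
Qed.

Let chiD k x y : chi k (x + y) = chi k x * chi k y.
Proof.
have kappaD i : kappa i (x + y) = kappa i x * kappa i y.
  by rewrite /kappa thetaD exprMn.
rewrite /chi; case: split => i; rewrite thetaD // mulrACA; congr (_ * _).
rewrite /link; case: ifP => // _; rewrite -big_split /=; apply: eq_bigr => j _.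
by rewrite kappaD exprMn.
Qed.

Let chiL i g : chi (lshift l.+1 i) g = theta (l + i) g * link i g.
Proof. by rewrite /chi -[lshift _ _]/(unsplit (inl _ i)) unsplitK. Qed.

Let chiR i g : chi (rshift l.+1 i) g = theta (l + i) g.
Proof. by rewrite /chi -[rshift _ _]/(unsplit (inr _ i)) unsplitK. Qed.

Let link_max g : link l g = \prod_(j < l) kappa j g ^+ q.-1.
Proof. by rewrite /link ltnn. Qed.

Section InvariantMonomial.

Variable a : 'I_(l.+1 + l.+1) -> nat.
Hypothesis a_inv : forall g, chi_mon chi a g = 1.
Let X i := a (lshift l.+1 i).
Let Y i := a (rshift l.+1 i).

Let chi_monE g : chi_mon chi a g =
  \prod_(i < l.+1) (theta (l + i) g * link i g) ^+ X i *
  \prod_(i < l.+1) theta (l + i) g ^+ Y i.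
Proof.
rewrite /chi_mon big_split_ord /=.
by congr (_ * _); apply: eq_bigr => i _; rewrite ?chiL ?chiR.
Qed.

(** Evaluate the invariant monomial at e_(l+i). *)
Lemma pair_dvd (i : 'I_l.+1) : (n (l + i) %| X i + Y i)%N.
Proof.
apply: theta_e; rewrite -[RHS](a_inv (e (l + i))) chi_monE exprD.
have kappa1 j : (j < l)%N -> kappa j (e (l + i)) = 1.
  by move=> jl; rewrite /kappa theta_ne ?expr1n // neq_ltn ltn_addr.
have link1 j : link j (e (l + i)) = 1.
  rewrite /link; case: ifP => [/kappa1 //|_].
  by rewrite big1 // => k _; rewrite kappa1 ?expr1n.
have ne (j : 'I_l.+1) : j != i -> theta (l + j) (e (l + i)) = 1.
  by move=> ji; rewrite theta_ne // eqn_add2l.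
congr (_ * _); rewrite (bigD1 i) //= ?link1 ?mulr1 big1 ?mulr1 // => j ji.
  by rewrite link1 ne // mulr1 expr1n.
by rewrite ne // expr1n.
Qed.

(** Evaluate the invariant monomial at e_i. *)
Lemma link_dvd (i : 'I_l) : (q %| X (widen_ord (leqnSn l) i) + q.-1 * X ord_max)%N.
Proof.
have q0 := prime_gt0 pq; have qn := q_dvd (ltn_ord i).
have m0 : (0 < n i %/ q)%N by rewrite divn_gt0 // dvdn_leq.
rewrite -(dvdn_pmul2l m0) divnK //.
apply: theta_e; rewrite -[RHS](a_inv (e i)) chi_monE.
have th1 (j : nat) : theta (l + j) (e i) = 1.
  by rewrite theta_ne // eq_sym neq_ltn ltn_addr.
have kappa1 (j : nat) : j != i -> kappa j (e i) = 1.
  by move=> ji; rewrite /kappa theta_ne ?expr1n.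
rewrite [X in _ * X]big1 ?mulr1 => [|j _]; last by rewrite th1 expr1n.
rewrite big_ord_recr /= th1 mul1r link_max (bigD1 i) //= big1 ?mulr1 => [|j ji]; last first.
  by rewrite th1 mul1r /link ltn_ord kappa1 ?expr1n.
rewrite th1 mul1r /link ltn_ord (bigD1 i) //= [X in _ * (_ * X) ^+ _]big1 => [|j ji]; last first.
  by rewrite kappa1 ?expr1n.
by rewrite mulr1 -exprM -exprD /kappa -exprM.
Qed.

(** If q does not divide X_l then by [link_dvd] no X_i vanishes, so each
    X_i + Y_i is a positive multiple of n_(l+i). *)
Lemma base_dvd : (\sum_k a k < \sum_(i < l.+1) n (l + i))%N -> (q %| X ord_max)%N.
Proof.
move=> lt; apply: contraLR lt => ndiv; rewrite -leqNgt.
have -> : (\sum_k a k = \sum_(i < l.+1) (X i + Y i))%N.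
  by rewrite big_split_ord [RHS]big_split.
apply: leq_sum => i _; apply: dvdn_leq (pair_dvd i).
rewrite addn_gt0; apply/orP; left; rewrite lt0n; apply: contra ndiv => /eqP Xi0.
have [eil|il] := eqVneq (i : nat) l.
  have <- : i = ord_max by apply: val_inj.
  by rewrite Xi0.
have lt_il : (i < l)%N by rewrite ltn_neqAle il -ltnS ltn_ord.
have := link_dvd (Ordinal lt_il).
have -> : widen_ord (leqnSn l) (Ordinal lt_il) = i by apply: val_inj.
rewrite Xi0 add0n Euclid_dvdM // => /orP[|//].
by have q1 := prime_gt1 pq; rewrite gtnNdvd; lia.
Qed.

End InvariantMonomial.

(** An element g carrying (1, ..., 1) to the second point would satisfy
    theta_(l+i)(g) = 1 from the coordinates Y_i, then kappa_i(g) = 1 from the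
    coordinates X_i, hence zeta = 1 from X_l. *)
Lemma long_module_not_separated d :
  (d < \sum_(i < l.+1) n (l + i))%N -> ~ separated_in_degree R [set: G]%G d.
Proof.
move=> lt_d; have [zeta zetaP] := prim_root_exists R[i] (prime_gt0 pq).
pose base := lshift l.+1 (@ord_max l).
pose w k := if k == base then zeta else 1.
apply: (not_separated_in_degree chi0 chiD (w := w)) => [g|a le_d a_inv].
  apply: contrapT => /forallNP H.
  have {}H k : chi k g = w k by apply: contrapT; apply: H.
  have th1 (i : 'I_l.+1) : theta (l + i) g = 1.
    by rewrite -chiR H /w eq_sym eq_lrshift.
  have kappa1 (i : 'I_l) : kappa i g = 1.
    pose i' := widen_ord (leqnSn l) i.
    have := H (lshift _ i'); rewrite chiL th1 mul1r /link /= ltn_ord => ->.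
    rewrite /w (inj_eq (@lshift_inj _ _)); case: eqP => // /(congr1 val) /= il.
    by have := ltn_ord i; rewrite il ltnn.
  have := H base; rewrite chiL th1 mul1r link_max /w eqxx big1 => [|j _]; last first.
    by rewrite kappa1 expr1n.
  move=> z1; have := prim_order_dvd zetaP 1; rewrite expr1 -z1 eqxx dvdn1.
  by case: q pq => [|[|]].
rewrite (bigD1 base) //= big1 ?mulr1 => [|k kb]; last by rewrite /w (negbTE kb) expr1n.
rewrite /w eqxx; apply/eqP; rewrite -(prim_order_dvd zetaP).
by apply: base_dvd => //; apply: leq_ltn_trans lt_d.
Qed.

End LongModule.

(** * Comparison of the two bounds *)

Section LengthBounds.

Variables (r : nat) (n : 'I_r -> nat).
Hypothesis r_ge2 : (2 <= r)%N.
Hypothesis n_gt1 : forall i, (1 < n i)%N.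
Hypothesis n_chain : forall i j : 'I_r, (i <= j)%N -> (n i %| n j)%N.

Local Notation nn := (extend_by_1 n).
Local Notation T := (\sum_(i < (r./2).+1) nn (r./2 + i))%N.

Lemma extend_by_1_gt0 i : (0 < nn i)%N.
Proof.
have [ir|ri] := ltnP i r; last by rewrite extend_by_1_out.
by rewrite (extend_by_1E n (Ordinal ir)) ltnW.
Qed.

Lemma n_mono (i j : 'I_r) : (i <= j)%N -> (n i <= n j)%N.
Proof. by move=> ij; apply: dvdn_leq; [rewrite ltnW | apply: n_chain]. Qed.

Lemma long_length_natE : T = (\sum_(r./2 <= i < (r./2 + r./2).+1) nn i)%N.
Proof.
set l := r./2; transitivity (\sum_(0 + l <= i < l.+1 + l) nn i)%N => //.
rewrite big_addn addnK big_mkord.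
by apply: eq_bigr => i _; rewrite addnC.
Qed.

Lemma n_lt_long_length i : (n i < T)%N.
Proof.
have lt_r : (r.-1 < r)%N by rewrite prednK // ltnW.
have le_last : (n i <= n (Ordinal lt_r))%N.
  by apply: n_mono => /=; rewrite -ltnS prednK // ltnW.
apply: leq_ltn_trans le_last _; rewrite -extend_by_1E /= long_length_natE.
have er := odd_double_half r.
rewrite (@big_cat_nat _ _ _ r.-1) /=; [|by lia|by lia].
have [ro|re] := boolP (odd r).
  have -> : (r./2 + r./2).+1 = r.-1.+1 by lia.
  rewrite big_nat1 -[X in (X < _)%N]add0n ltn_add2r.
  rewrite big_ltn; last by lia.
  by rewrite ltn_addr // extend_by_1_gt0.
have -> : (r./2 + r./2).+1 = r.-1.+2 by lia.
rewrite [X in (_ < _ + X)%N]big_ltn ?leqnSn // big_nat1.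
by have := extend_by_1_gt0 r.-1.+1; lia.
Qed.

(** With t = uphalf k, the left side is (k - 2(t - 1)) n_c + 2 sum_(i > c) n_i,
    and k - 2(t - 1) is 2 or 1 according to the parity of k. The terms n_i with
    c <= i < r all occur in T. For even r there is moreover the padding term 1;
    for odd r either c > r/2, which leaves n_(r/2) unused, or k = r is odd and
    n_c is counted only once on the left. *)
Lemma box_le_long_length k (c : 'I_r) : (1 < k <= r)%N -> (c + uphalf k = r)%N ->
  (k * n c + 2 * \sum_(i : 'I_r | c < i) (n i - n c) <= (2 * T.-1).+1)%N.
Proof.
move=> /andP[k1 kr] ec.
pose A := (\sum_(c.+1 <= i < r) nn i)%N.
have eA : (\sum_(i : 'I_r | c < i) (n i - n c) + (uphalf k).-1 * n c = A)%N.
  have -> : A = (\sum_(i : 'I_r | c < i) n i)%N.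
    rewrite /A (@big_nat_widenl _ _ _ c.+1 0) // big_mkord.
    by apply: eq_bigr => i _; rewrite extend_by_1E.
  have -> : ((uphalf k).-1 * n c = \sum_(i : 'I_r | c < i) n c)%N.
    rewrite -(big_mkord (fun i => c < i)%N (fun=> n c)) -(@big_nat_widenl _ _ _ c.+1 0 _ xpredT) //.
    by rewrite sum_nat_const_nat; congr (_ * _)%N; lia.
  by rewrite -big_split; apply: eq_bigr => i ci /=; rewrite subnK // n_mono // ltnW.
have eS : (n c + A = \sum_(c <= i < r) nn i)%N.
  by rewrite [RHS]big_ltn // extend_by_1E.
have er := odd_double_half r; have ek := odd_double_half k; have uk := uphalf_half k.
have n0 := n_gt1 c.
have lc : (r./2 <= c)%N by lia.
have eL : (k * n c + 2 * \sum_(i : 'I_r | c < i) (n i - n c) = (2 - odd k) * n c + 2 * A)%N.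
  have e : k = (2 * (uphalf k).-1 + (2 - odd k))%N by lia.
  by rewrite -eA {1}e mulnDl -mulnA mulnDr; lia.
rewrite {}eL long_length_natE.
have cr := ltn_ord c.
have eT : (\sum_(r./2 <= i < r) nn i = \sum_(r./2 <= i < c) nn i + (n c + A))%N.
  by rewrite eS -big_cat_nat // ltnW.
have [ro|re] := boolP (odd r).
  have -> : (r./2 + r./2).+1 = r by lia.
  rewrite eT; have [elc|nlc] := eqVneq (c : nat) r./2.
    have ko : odd k by lia.
    by rewrite ko; lia.
  rewrite big_ltn; last by lia.
  by have := extend_by_1_gt0 r./2; case: (odd k); lia.
have -> : (r./2 + r./2)%N = r by lia.
rewrite big_nat_recr /=; last by lia.
by rewrite eT extend_by_1_out //; case: (odd k); lia.
Qed.

End LengthBounds.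

Lemma smallest_subgroup (V : zmodType) (X : set V) :
  is_subgroup (smallest (@is_subgroup V) X).
Proof.
split=> [M [[]]|x y Hx Hy M HM] //.
by case: (HM) => -[_ MB] _; apply: MB; [apply: Hx | apply: Hy].
Qed.

Theorem corollary1p4 (R : realType) (G : finZmodType) (r : nat) (n : 'I_r -> nat)
    (hr : (2 <= r)%N)
    (hn1 : forall i : 'I_r, (1 < n i)%N)
    (hdvd : forall i j : 'I_r, (i <= j)%N -> (n i %| n j)%N)
    (hG : [set: G] \isog [set: {dffun forall i : 'I_r, 'Z_(n i)}])
    (G0 : {set G}) (hG0 : (#|G0| <= r.+1)%N)
    (A : sequence G) (hA : separating_atom_over G0 A)
    (hlen : is_beta_sep R [set: G]%G (seq_length A)) :
  #|seq_supp A| = #|G0| /\ #|G0| = r.+1.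
Proof.
case: hA => -[[AG0 A0] _ _] Asep; case: hlen => _ Adeg _.
suff lt_r : (r < #|seq_supp A|)%N.
  by have := subset_leq_card AG0; lia.
rewrite ltnNge; apply/negP => supp_le; apply: Asep.
pose T := (\sum_(i < (r./2).+1) extend_by_1 n (r./2 + i))%N.
have n_gt0 i : (0 < n i)%N by apply: ltnW.
have le_T : (T <= seq_length A)%N.
  rewrite leqNgt; apply/negP => lt_T.
  have [theta [e [th0 thD the thne]]] := dual_characters R hn1 hG.
  have r0 : (0 < r)%N by apply: ltnW.
  have pq : prime (pdiv (n (Ordinal r0))) by apply: pdiv_prime.
  apply: (long_module_not_separated pq _ (extend_by_1_gt0 hn1) th0 thD the thne lt_T) => //.
  move=> i il; have ir : (i < r)%N by have := odd_double_half r; lia.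
  rewrite (extend_by_1E n (Ordinal ir)); apply: dvdn_trans (pdiv_dvd _) _.
  exact: hdvd.
have T0 : (0 < T)%N by apply: leq_ltn_trans (n_lt_long_length hr hn1 hdvd (Ordinal hr)).
have [f [b [_ _ b_ord b_gen]]] := cyclic_basis hn1 hG.
have b_gen' g : exists c : 'I_r -> nat, g = \sum_i b i *+ c i.
  by exists (fun i => f g i).
set P := quotient_of_bounded _ _.
have subP : is_subgroup P by apply: smallest_subgroup.
apply: (localized_all subP) => q pq.
apply: (relation_generated (d := T.-1) n_gt0 hdvd b_ord b_gen' pq (localized_subgroup subP pq)
  _ _ _ supp_le _ (subxx (seq_supp A))) => [x e|S SA S0 Sd|i|k c|].
- exact: localized_sat.
- apply: sub_localized => //; move=> M [_ XM]; apply: XM; exists S => //.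
  split; first by split=> //; apply: subset_trans SA AG0.
  by apply: leq_trans Sd _; lia.
- by rewrite -ltnS prednK //; apply: n_lt_long_length.
- exact: box_le_long_length.
split=> [g|]; last by rewrite int_sum_to_quotient.
by rewrite inE -eqn0Ngt ffunE => /eqP ->.
Qed.
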